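(* Let $i,j$ be positive integers. If $(i,j)\neq(1,1)$, $(i,j)\neq(2,2)$, and $i\geq \min(j,4)$, then White has a winning strategy in Multimove Chess $(i,j)$. Otherwise (i.e. if $(i,j)\notin\{(1,1),(2,2)\}$ and $i<\min(j,4)$), Black has a winning strategy in Multimove Chess $(i,j)$.
   Context: For positive integers $i,j$, Multimove Chess $(i,j)$ is the game played with exactly the rules of standard chess (standard starting position, standard piece moves, White plays first), except that on each of its turns White makes $i$ consecutive moves and on each of its turns Black makes $j$ consecutive moves. A side wins when it captures the opponent's king. A side ''has a winning strategy'' if it has a strategy guaranteed to win regardless of the opponent's play. *)

(* Defs.v *)
From HB Require Import structures.
From mathcomp Require Import all_boot.

Set Implicit Arguments.
Unset Strict Implicit.
Unset Printing Implicit Defensive.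

Inductive color := White | Black.
Inductive kind := Pawn | Knight | Bishop | Rook | Queen | King.
Inductive wing := Kingside | Queenside.

Definition color_dec : comparable color.
Proof. move=> x y; rewrite /decidable; decide equality. Defined.
HB.instance Definition _ := hasDecEq.Build color (compareP color_dec).

Definition kind_dec : comparable kind.
Proof. move=> x y; rewrite /decidable; decide equality. Defined.
HB.instance Definition _ := hasDecEq.Build kind (compareP kind_dec).

Definition opp (c : color) : color := if c is White then Black else White.

(* (file, rank), both counted from 0: a1 is (0, 0) and h8 is (7, 7). *)
Definition square := (nat * nat)%type.
Definition on_board (s : square) : bool := (s.1 < 8) && (s.2 < 8).
Definition squares : seq square := [seq (f, r) | f <- iota 0 8, r <- iota 0 8].

Definition man := (color * kind)%type.
Definition board := square -> option man.
Definition owner (b : board) (s : square) : option color := omap fst (b s).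

Definition wings : seq wing := [:: Kingside; Queenside].
Definition home_rank (c : color) : nat := if c is White then 0 else 7.
Definition pawn_rank (c : color) : nat := if c is White then 1 else 6.
Definition king_home (c : color) : square := (4, home_rank c).
Definition king_dest (c : color) (w : wing) : square :=
  (if w is Kingside then 6 else 2, home_rank c).
Definition rook_home (c : color) (w : wing) : square :=
  (if w is Kingside then 7 else 0, home_rank c).
(* also the square crossed by the king when castling *)
Definition rook_dest (c : color) (w : wing) : square :=
  (if w is Kingside then 5 else 3, home_rank c).

Definition initial_board : board := fun s =>
  let pieces :=
    onth [:: Rook; Knight; Bishop; Queen; King; Bishop; Knight; Rook] s.1 in
  let pawns := onth (nseq 8 Pawn) s.1 in
  match s.2 with
  | 0 => omap (pair White) pieces
  | 1 => omap (pair White) pawns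
  | 6 => omap (pair Black) pawns
  | 7 => omap (pair Black) pieces
  | _ => None
  end.

Definition gap (a b : nat) : nat := (a - b) + (b - a).
Definition toward (a b k : nat) : nat :=
  if a < b then a + k else if b < a then a - k else a.

(* The squares strictly between s and t; meaningful only when s and t lie on a
   common rank, file or diagonal. *)
Definition between (s t : square) : seq square :=
  [seq (toward s.1 t.1 k, toward s.2 t.2 k)
     | k <- iota 1 (maxn (gap s.1 t.1) (gap s.2 t.2)).-1].

Definition clear (b : board) (s t : square) : bool :=
  all (fun u => b u == None) (between s t).

Definition straight (s t : square) : bool :=
  (s != t) && ((s.1 == t.1) || (s.2 == t.2)).
Definition diagonal (s t : square) : bool :=
  (s != t) && (gap s.1 t.1 == gap s.2 t.2).

Definition forward (c : color) (n : nat) (s t : square) : bool :=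
  if c is White then t.2 == s.2 + n else s.2 == t.2 + n.

(* The man on s attacks t, whatever stands on t. *)
Definition attacks (b : board) (s t : square) : bool :=
  let df := gap s.1 t.1 in
  let dr := gap s.2 t.2 in
  match b s with
  | None => false
  | Some (c, Pawn) => (df == 1) && forward c 1 s t
  | Some (_, Knight) => ((df == 1) && (dr == 2)) || ((df == 2) && (dr == 1))
  | Some (_, Bishop) => diagonal s t && clear b s t
  | Some (_, Rook) => straight s t && clear b s t
  | Some (_, Queen) => (straight s t || diagonal s t) && clear b s t
  | Some (_, King) => maxn df dr == 1
  end.

Definition attacked_by (b : board) (c : color) (t : square) : bool :=
  has (fun s => (owner b s == Some c) && attacks b s t) squares.

(* Castling is written as the two-square move of the king. *)
Record move := Move { src : square; dst : square; promotion : option kind }.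

Record position := Position {
  men : board;
  (* neither the king nor the rook in question has moved or been captured *)
  castling_right : color -> wing -> bool;
  (* the square of a pawn that advanced two squares on the very last single
     move *)
  two_step : option square;
  mover : color;
  (* single moves left in the current turn, the one about to be made included *)
  moves_left : nat }.

Definition promotion_kinds : seq kind := [:: Queen; Rook; Bishop; Knight].

Definition promotion_ok (p : position) (m : move) : bool :=
  if (men p (src m) == Some (mover p, Pawn))
     && ((dst m).2 == home_rank (opp (mover p)))
  then promotion m \in map some promotion_kinds
  else promotion m == None.

Definition pawn_advance (p : position) (m : move) : bool :=
  let: Move s t _ := m in
  [&& s.1 == t.1, clear (men p) s t, men p t == None
    & forward (mover p) 1 s t
      || (s.2 == pawn_rank (mover p)) && forward (mover p) 2 s t].

(* The victim stands on the rank of src and on the file of dst. *)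
Definition en_passant (p : position) (m : move) : bool :=
  let: Move s t _ := m in
  [&& men p s == Some (mover p, Pawn), attacks (men p) s t, men p t == None,
      two_step p == Some (t.1, s.2)
    & men p (t.1, s.2) == Some (opp (mover p), Pawn)].

Definition castles (w : wing) (p : position) (m : move) : bool :=
  let: Move s t _ := m in
  [&& men p s == Some (mover p, King), s == king_home (mover p)
    & t == king_dest (mover p) w].

Definition castling_ok (p : position) (w : wing) : bool :=
  let c := mover p in
  [&& castling_right p c w, clear (men p) (king_home c) (rook_home c w)
    & all (fun s => ~~ attacked_by (men p) (opp c) s)
          [:: king_home c; rook_dest c w; king_dest c w]].

(* As the game is won by capturing the king, a king may be left or put in
   check, and may be captured like any other man. *)
Definition legal (p : position) (m : move) : bool :=
  let: Move s t _ := m in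
  let b := men p in
  let c := mover p in
  let plain := attacks b s t && (owner b t != Some c) in
  [&& on_board s, on_board t, owner b s == Some c, promotion_ok p m
    & match b s with
      | None => false
      | Some (_, Pawn) =>
          [|| pawn_advance p m, attacks b s t && (owner b t == Some (opp c))
            | en_passant p m]
      | Some (_, King) =>
          plain || has (fun w => castles w p m && castling_ok p w) wings
      | Some (_, _) => plain
      end].

Definition can_move (p : position) : bool :=
  has (fun s => has (fun t => has (fun k => legal p (Move s t k))
    (None :: map some promotion_kinds)) squares) squares.

Definition board_after (p : position) (m : move) : board :=
  let: Move s t k := m in
  let c := mover p in
  let placed := if k is Some k' then Some (c, k') else men p s in
  let ep := en_passant p m in
  let castled := ohead [seq w <- wings | castles w p m] in
  fun u =>
    if u == t then placed
    else if (u == s) || ep && (u == (t.1, s.2)) then None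
    else if castled is Some w then
      if u == rook_home c w then None
      else if u == rook_dest c w then Some (c, Rook)
      else men p u
    else men p u.

(* In the game (i, j), a turn of White consists of i moves and a turn of Black
   of j moves. *)
Definition quota (i j : nat) (c : color) : nat := if c is White then i else j.

Definition position_after (i j : nat) (p : position) (m : move) : position :=
  let: Move s t _ := m in
  let c := mover p in
  let turn_over := moves_left p <= 1 in
  {| men := board_after p m;
     castling_right := fun d w =>
       castling_right p d w
       && ~~ has (mem [:: king_home d; rook_home d w]) [:: s; t];
     two_step :=
       if (men p s == Some (c, Pawn)) && forward c 2 s t then Some t else None;
     mover := if turn_over then opp c else c;
     moves_left := if turn_over then quota i j (opp c) else (moves_left p).-1 |}.

Definition start (i j : nat) : position :=
  {| men := initial_board;
     castling_right := fun _ _ => true;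
     two_step := None;
     mover := White;
     moves_left := quota i j White |}.

(* For repetitions, a two-step matters only if the pawn can be captured en
   passant. *)
Definition en_passant_possible (p : position) : option square :=
  if has (fun s => has (fun t => en_passant p (Move s t None)) squares) squares
  then two_step p else None.

Definition same_position (p q : position) : bool :=
  [&& all (fun s => men p s == men q s) squares,
      all (fun c => all (fun w => castling_right p c w == castling_right q c w)
        wings) [:: White; Black],
      en_passant_possible p == en_passant_possible q,
      mover p == mover q
    & moves_left p == moves_left q].

Record game := Game {
  current : position;
  past : seq position;
  (* single moves made by each side since the last capture or pawn move *)
  quiet : color -> nat }.

Definition initial_game (i j : nat) : game :=
  Game (start i j) [::] (fun _ => 0).

Definition irreversible (p : position) (m : move) : bool :=
  (men p (src m) == Some (mover p, Pawn)) || (men p (dst m) != None).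

Definition play (i j : nat) (g : game) (m : move) : game :=
  let p := current g in
  Game (position_after i j p m) (p :: past g)
    (fun c => if irreversible p m then 0 else quiet g c + (c == mover p)).

Definition threefold_repetition (g : game) : bool :=
  2 <= count (same_position (current g)) (past g).
Definition fifty_moves (g : game) : bool :=
  (50 <= quiet g White) && (50 <= quiet g Black).

Inductive status := Ongoing | Won of color | Drawn.

Definition king_captured (b : board) (c : color) : bool :=
  ~~ has (fun s => b s == Some (c, King)) squares.

(* A side without a legal move is stalemated.  Threefold repetition and the
   fifty-move rule count as draws outright, since the opponent of a would-be
   winner is entitled to claim them.  Dead positions need no clause: no win can
   be reached from them. *)
Definition status_of (g : game) : status :=
  if king_captured (men (current g)) Black then Won White
  else if king_captured (men (current g)) White then Won Black
  else if [|| ~~ can_move (current g), threefold_repetition g | fifty_moves g]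
       then Drawn
  else Ongoing.

(* A game carries its whole past, so strategies may depend on the history. *)
Definition strategy := game -> move.

Definition legal_strategy (c : color) (sigma : strategy) : Prop :=
  forall g, status_of g = Ongoing -> mover (current g) = c ->
    legal (current g) (sigma g).

Definition advance (i j : nat) (sigma : color -> strategy) (g : game) : game :=
  if status_of g is Ongoing then play i j g (sigma (mover (current g)) g)
  else g.

Definition game_at (i j : nat) (sigma : color -> strategy) (n : nat) : game :=
  iter n (advance i j sigma) (initial_game i j).

Definition winning_strategy (i j : nat) (c : color) (sigma : strategy) : Prop :=
  legal_strategy c sigma /\
  forall tau : strategy, legal_strategy (opp c) tau ->
    exists n : nat,
      status_of (game_at i j (fun d => if d == c then sigma else tau) n)
      = Won c.

Definition has_winning_strategy (i j : nat) (c : color) : Prop :=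
  exists sigma : strategy, winning_strategy i j c sigma.

(* Main.v *)
(* In every case the game is decided within three turns of the winner.  With at
   least four moves a knight captures the king at once: Nc3, Nd5, Nxc7, Nxe8, or
   for Black Na6, Nc5, Nd3, Nxe1 with a few substitutes when three white moves
   have disturbed this route.  Otherwise White starts with Nc3, Nd5 in (2, 1) and
   with e4, Qf3, Nc3 in (3, 1), (3, 2) and (3, 3), after which every black turn
   leaves a capture of the king.  In (1, 3) and (2, 3) a first black turn such as
   Nf6, Rg8, Nc6 works in the same way; in (1, 2) the reply to 1. e3 gains only
   one more round of threats.  These finite claims are established by a verified
   search: the opponent's moves are enumerated (generously, allowing some
   illegal castlings and en passant captures), and the winner's are taken from
   short lists of plans, tried in order.  The wins come before a position can
   occur for the third time, except in (1, 2), where the search compares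
   positions. *)

Require Import Defs.
From Stdlib Require Import Ascii String.
From mathcomp Require Import all_boot.

Set Implicit Arguments.
Unset Strict Implicit.
Unset Printing Implicit Defensive.

(** * From forced wins to strategies *)

Lemma oppK : involutive opp.
Proof. by case. Qed.

Lemma opp_neq c : (opp c == c) = false.
Proof. by case: c. Qed.

Lemma neq_opp c d : d != c -> d = opp c.
Proof. by case: c; case: d. Qed.

Lemma mem_squares s : (s \in squares) = on_board s.
Proof.
apply/idP/idP => [/allpairsP[[x y] [in_x in_y ->]] | /andP[lt_f lt_r]].
  by rewrite !mem_iota in in_x in_y; apply/andP.
apply/allpairsP; exists s; rewrite !mem_iota lt_f lt_r.
by case: s {lt_f lt_r}.
Qed.

(** Unlike the record [move], triples have decidable equality, so that membership in a list makes
    sense. *)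
Definition move_code := (square * square * option kind)%type.

Definition to_move (x : move_code) : move := Move x.1.1 x.1.2 x.2.

(* Locked, since simplification would expand its 20480 elements. *)
Definition move_codes : seq move_code := locked
  [seq (st, k) | st <- [seq (s, t) | s <- squares, t <- squares],
                 k <- None :: map some promotion_kinds].

Lemma mem_move_codes s t k : s \in squares -> t \in squares ->
  k \in None :: map some promotion_kinds -> (s, t, k) \in move_codes.
Proof.
by rewrite /move_codes -lock => in_s in_t; apply: allpairs_f; apply: allpairs_f.
Qed.

Lemma promotion_code p m :
  promotion_ok p m -> promotion m \in None :: map some promotion_kinds.
Proof.
rewrite /promotion_ok; case: ifP => _; last by move/eqP->.
by move=> in_k; rewrite in_cons in_k orbT.
Qed.

Lemma legal_code p m :
  legal p m -> exists2 x, x \in move_codes & to_move x = m.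
Proof.
case: m => s t k /and5P[on_s on_t _ ok_k _]; exists (s, t, k) => //.
by apply: mem_move_codes; rewrite ?mem_squares // (promotion_code ok_k).
Qed.

Lemma legal_can_move p m : legal p m -> can_move p.
Proof.
case: m => s t k leg; move: (leg) => /and5P[on_s on_t _ ok_k _].
apply/hasP; exists s; rewrite ?mem_squares //.
apply/hasP; exists t; rewrite ?mem_squares //.
by apply/hasP; exists k; rewrite // (promotion_code ok_k).
Qed.

Lemma can_move_code p :
  can_move p -> has (fun x => legal p (to_move x)) move_codes.
Proof.
case/hasP=> s in_s /hasP[t in_t /hasP[k in_k leg]].
by apply/hasP; exists (s, t, k) => //; apply: mem_move_codes.
Qed.

Lemma ongoing_can_move g : status_of g = Ongoing -> can_move (current g).
Proof.
by rewrite /status_of; do 2![case: ifP => // _]; case: (can_move _).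
Qed.

(** * Backward induction on the number of single moves *)

Section Forcing.

Variables (i j : nat) (c : color).

(** The fuel [n] counts single moves of both sides. The universal clause is never vacuous, since an
    [Ongoing] game has a legal move. *)
Fixpoint forced (n : nat) (g : game) : bool :=
  match status_of g with
  | Won d => d == c
  | Drawn => false
  | Ongoing =>
      if n is n'.+1 then
        let next x := forced n' (play i j g (to_move x)) in
        if mover (current g) == c
        then has (fun x => legal (current g) (to_move x) && next x) move_codes
        else all (fun x => legal (current g) (to_move x) ==> next x) move_codes
      else false
  end.

Lemma forced_won n g : status_of g = Won c -> forced n g.
Proof. by case: n => [|n] /= ->. Qed.

Lemma forced_decided n g d : forced n g -> status_of g = Won d -> d = c.
Proof. by case: n => [|n] /= f_n on_g; rewrite on_g in f_n; apply/eqP. Qed.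

Lemma forced_ongoing n g : status_of g = Ongoing ->
  forced n.+1 g =
    if mover (current g) == c
    then has (fun x => legal (current g) (to_move x)
                       && forced n (play i j g (to_move x))) move_codes
    else all (fun x => legal (current g) (to_move x)
                       ==> forced n (play i j g (to_move x))) move_codes.
Proof. by move=> /= ->. Qed.

Lemma forced_choose n g m : status_of g = Ongoing -> mover (current g) = c ->
  legal (current g) m -> forced n (play i j g m) -> forced n.+1 g.
Proof.
move=> on_g c_g leg next; rewrite forced_ongoing // c_g eqxx.
by have [x in_x xE] := legal_code leg; apply/hasP; exists x => //; rewrite xE leg.
Qed.

Lemma forced_respond n g : status_of g = Ongoing -> mover (current g) = opp c ->
  (forall m, legal (current g) m -> forced n (play i j g m)) -> forced n.+1 g.
Proof.
move=> on_g c_g next; rewrite forced_ongoing // c_g opp_neq.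
by apply/allP=> x _; apply/implyP/next.
Qed.

(* Playing a move that minimizes the remaining depth, rather than any move that
   keeps the win, is what makes the game end. *)
Definition forcing_move (bound : nat) (g : game) : move :=
  let n := find (forced^~ g) (iota 0 bound.+1) in
  let ok x := legal (current g) (to_move x) in
  let good x := ok x && forced n.-1 (play i j g (to_move x)) in
  let choice := if has good move_codes then good else ok in
  to_move (nth ((0, 0), (0, 0), None) move_codes (find choice move_codes)).

(** A strategy must be legal in every ongoing game, also one that is not won; there [forcing_move]
    falls back on any legal move. *)
Lemma forcing_move_legal bound g :
  status_of g = Ongoing -> legal (current g) (forcing_move bound g).
Proof.
move=> /ongoing_can_move/can_move_code has_ok; rewrite /forcing_move.
by case: ifP => [has_good | _]; [case/andP: (nth_find ((0, 0), (0, 0), None) has_good)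
  | apply: (nth_find ((0, 0), (0, 0), None) has_ok)].
Qed.

(** The least depth [k] at which [g] is forced is at most [n] and, the game being ongoing, positive;
    a good move leaves [k - 1]. *)
Lemma forcing_move_forced bound n g : n <= bound -> forced n g ->
    status_of g = Ongoing -> mover (current g) = c ->
  exists2 n', n' < n & forced n' (play i j g (forcing_move bound g)).
Proof.
move=> le_n f_n on_g c_g; rewrite /forcing_move.
set k := find (forced^~ g) _.
have has_f : has (forced^~ g) (iota 0 bound.+1).
  by apply/hasP; exists n => //; rewrite mem_iota.
have lt_k : k < bound.+1 by move: has_f; rewrite has_find size_iota.
have f_k : forced k g.
  by move: (nth_find 0 has_f); rewrite -/k nth_iota // add0n.
have le_k : k <= n.
  rewrite leqNgt; apply/negP=> lt_n.
  by have := before_find 0 lt_n; rewrite nth_iota ?ltnS // add0n f_n.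
case: k {has_f} lt_k f_k le_k => [|k] lt_k; first by rewrite /= on_g.
rewrite forced_ongoing // c_g eqxx => has_good lt_n; exists k => //=.
by rewrite has_good; case/andP: (nth_find ((0, 0), (0, 0), None) has_good).
Qed.

(** Strong induction on the depth, which drops with every single move: by the choice of
    [forcing_move] on one side, by the universal clause of [forced] on the other. *)
Theorem forced_has_winning_strategy bound :
  forced bound (initial_game i j) -> has_winning_strategy i j c.
Proof.
move=> f_init; exists (forcing_move bound); split=> [g on_g _|tau leg_tau].
  exact: forcing_move_legal.
pose sigma d := if d == c then forcing_move bound else tau.
suff reach n g : forced n g -> n <= bound ->
    exists t, status_of (iter t (advance i j sigma) g) = Won c.
  exact: reach f_init (leqnn _).
elim/ltn_ind: n g => n IHn g f_n le_n.
case on_g: (status_of g) => [|d|]; last 2 first.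
- by exists 0; rewrite -(forced_decided f_n on_g).
- by move: f_n; case: n {IHn le_n} => [|n]; rewrite /= on_g.
have advE : advance i j sigma g = play i j g (sigma (mover (current g)) g).
  by rewrite /advance on_g.
suff [n' lt_n f_n'] : exists2 n', n' < n & forced n' (advance i j sigma g).
  have [t tE] := IHn n' lt_n _ f_n' (leq_trans (ltnW lt_n) le_n).
  by exists t.+1; rewrite iterSr.
rewrite advE /sigma; case: eqP => [c_g | /eqP/neq_opp c_g].
  exact: forcing_move_forced.
case: n {IHn le_n} f_n => [|n]; first by rewrite /= on_g.
rewrite forced_ongoing // c_g opp_neq => /allP f_n; exists n => //.
have leg := leg_tau _ on_g c_g.
by have [x in_x xE] := legal_code leg; move: (f_n x in_x); rewrite xE leg.
Qed.

End Forcing.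

(** * The moves available on a grid *)

Definition lookup T (x0 : T) (tab : seq (seq T)) (s : square) : T :=
  nth x0 (nth [::] tab s.1) s.2.

Definition tabulate T (f : square -> T) : seq (seq T) :=
  [seq [seq f (x, y) | y <- iota 0 8] | x <- iota 0 8].

Lemma lookup_tabulate T (x0 : T) f s :
  on_board s -> lookup x0 (tabulate f) s = f s.
Proof.
case: s => x y /andP[lt_x lt_y]; rewrite /lookup /tabulate.
by rewrite (nth_map 0) ?size_iota // (nth_map 0) ?size_iota // !nth_iota.
Qed.

(** Boards as functions would grow a closure with every move; nested lists, by file and then rank,
    reduce to data. *)
Definition grid := seq (seq (option man)).

Definition cell (b : grid) : board := lookup None b.

Definition put (b : grid) (s : square) (x : option man) : grid :=
  set_nth [::] b s.1 (set_nth None (nth [::] b s.1) s.2 x).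

(** True off the board too, since [set_nth] pads with the very defaults that reading returns. *)
Lemma cell_put b s x u : cell (put b s x) u = if u == s then x else cell b u.
Proof.
case: s u => s1 s2 [u1 u2]; rewrite /cell /lookup /put /= nth_set_nth /= xpair_eqE.
by case: eqP => [->|] //=; rewrite nth_set_nth /=; case: eqP.
Qed.

(* The checks below are evaluated many times; comparing constructors and unary
   numbers directly spares unfolding the generic equality test. *)
Definition same_color (c d : color) : bool :=
  match c, d with White, White | Black, Black => true | _, _ => false end.

Definition same_kind (k l : kind) : bool :=
  match k, l with
  | Pawn, Pawn | Knight, Knight | Bishop, Bishop
  | Rook, Rook | Queen, Queen | King, King => true
  | _, _ => false
  end.

Definition same_square (s t : square) : bool :=
  if eqn s.1 t.1 then eqn s.2 t.2 else false.

Lemma same_colorE c d : same_color c d = (c == d).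
Proof. by case: c; case: d. Qed.

Lemma same_kindE k l : same_kind k l = (k == l).
Proof. by case: k; case: l. Qed.

Lemma same_squareE s t : same_square s t = (s == t).
Proof. by case: s t => [s1 s2] [t1 t2]; rewrite /same_square xpair_eqE !eqnE. Qed.

Definition vacant (b : grid) (s : square) : bool :=
  if cell b s is None then true else false.

Definition holds (b : grid) (s : square) (c : color) (k : kind) : bool :=
  if cell b s is Some (d, l) then
    if same_color c d then same_kind k l else false
  else false.

Definition owned (b : grid) (s : square) (c : color) : bool :=
  if cell b s is Some (d, _) then same_color c d else false.

Lemma vacantE b s : vacant b s = (cell b s == None).
Proof. by rewrite /vacant; case: (cell b s). Qed.

Lemma holdsE b s c k : holds b s c k = (cell b s == Some (c, k)).
Proof.
rewrite /holds; case: (cell b s) => // -[d l].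
by rewrite same_colorE same_kindE [RHS]eq_sym.
Qed.

Lemma ownedE b s c : owned b s c = (owner (cell b) s == Some c).
Proof.
rewrite /owned /owner; case: (cell b s) => // -[d l] /=.
by rewrite same_colorE [RHS]eq_sym.
Qed.

(* Unlike [has] and [all], whose boolean connectives are strict under
   [vm_compute], these stop at the first decisive element. *)
Fixpoint any T (a : pred T) (s : seq T) : bool :=
  if s is x :: s' then if a x then true else any a s' else false.

Fixpoint every T (a : pred T) (s : seq T) : bool :=
  if s is x :: s' then if a x then every a s' else false else true.

Lemma anyE T (a : pred T) s : any a s = has a s.
Proof. by elim: s => //= x s ->. Qed.

Lemma everyE T (a : pred T) s : every a s = all a s.
Proof. by elim: s => //= x s ->. Qed.

(** * Tables of piece moves *)

Definition crossed (k : kind) (s t : square) : seq square :=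
  if k is (Bishop | Rook | Queen) then between s t else [::].

(** The part of [attacks] that ignores the other men, hence can be tabulated in advance. Pawns are
    left to [pushes] and [strikes]. *)
Definition geometry (k : kind) (s t : square) : bool :=
  let df := gap s.1 t.1 in
  let dr := gap s.2 t.2 in
  match k with
  | Pawn => false
  | Knight => ((df == 1) && (dr == 2)) || ((df == 2) && (dr == 1))
  | Bishop => diagonal s t
  | Rook => straight s t
  | Queen => straight s t || diagonal s t
  | King => maxn df dr == 1
  end.

Definition pushes (c : color) (s t : square) : bool :=
  (s.1 == t.1)
  && (forward c 1 s t || (s.2 == pawn_rank c) && forward c 2 s t).

Definition strikes (c : color) (s t : square) : bool :=
  (gap s.1 t.1 == 1) && forward c 1 s t.

Definition range_table (k : kind) : seq (seq (seq (seq square * square))) :=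
  Eval vm_compute in
  let tab k := tabulate (fun s => [seq (crossed k s t, t) | t <- squares & geometry k s t])
  in match k with
     | Pawn => tab Pawn | Knight => tab Knight | Bishop => tab Bishop
     | Rook => tab Rook | Queen => tab Queen | King => tab King
     end.

Definition push_table (c : color) : seq (seq (seq (seq square * square))) :=
  Eval vm_compute in
  let tab c := tabulate (fun s => [seq (between s t, t) | t <- squares & pushes c s t])
  in match c with White => tab White | Black => tab Black end.

Definition strike_table (c : color) : seq (seq (seq square)) :=
  Eval vm_compute in
  let tab c := tabulate (fun s => [seq t <- squares | strikes c s t])
  in match c with White => tab White | Black => tab Black end.

Lemma mem_range k s t : on_board s -> on_board t -> geometry k s t ->
  (crossed k s t, t) \in lookup [::] (range_table k) s.
Proof.
move=> on_s on_t geo_k.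
have -> : range_table k =
    tabulate (fun s => [seq (crossed k s t, t) | t <- squares & geometry k s t]).
  by case: k {geo_k}; vm_compute.
rewrite lookup_tabulate //; apply/mapP; exists t => //.
by rewrite mem_filter geo_k mem_squares.
Qed.

Lemma mem_push c s t : on_board s -> on_board t -> pushes c s t ->
  (between s t, t) \in lookup [::] (push_table c) s.
Proof.
move=> on_s on_t push_c.
have -> : push_table c =
    tabulate (fun s => [seq (between s t, t) | t <- squares & pushes c s t]).
  by case: c {push_c}; vm_compute.
rewrite lookup_tabulate //; apply/mapP; exists t => //.
by rewrite mem_filter push_c mem_squares.
Qed.

Lemma mem_strike c s t : on_board s -> on_board t -> strikes c s t ->
  t \in lookup [::] (strike_table c) s.
Proof.
move=> on_s on_t strike_c.
have -> : strike_table c = tabulate (fun s => [seq t <- squares | strikes c s t]).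
  by case: c {strike_c}; vm_compute.
by rewrite lookup_tabulate // mem_filter strike_c mem_squares.
Qed.

(* Source, destination, man placed on the destination, and the changes to other
   squares (en passant victim, castling rook). *)
Definition effect := (square * square * man * seq (square * option man))%type.

Definition apply_effect (b : grid) (e : effect) : grid :=
  let: (s, t, x, changes) := e in
  put (put (foldl (fun b' y => put b' y.1 y.2) b changes) s None) t (Some x).

Definition placed_kinds (c : color) (t : square) : seq kind :=
  if t.2 == home_rank (opp c) then promotion_kinds else [:: Pawn].

Definition pawn_effects (c : color) (b : grid) (s : square) : seq effect :=
  flatten [seq if every (vacant b) (x.2 :: x.1)
               then [seq (s, x.2, (c, k), [::]) | k <- placed_kinds c x.2]
               else [::]
             | x <- lookup [::] (push_table c) s]
  ++ flatten [seq if owned b t (opp c)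
                  then [seq (s, t, (c, k), [::]) | k <- placed_kinds c t]
                  else if if vacant b t then holds b (t.1, s.2) (opp c) Pawn else false
                  then [seq (s, t, (c, k), [:: ((t.1, s.2), None)])
                          | k <- placed_kinds c t]
                  else [::]
                | t <- lookup [::] (strike_table c) s].

Definition castling_effects (c : color) (b : grid) (s : square) : seq effect :=
  if same_square s (king_home c) then
    [seq (s, king_dest c w, (c, King),
          [:: (rook_dest c w, Some (c, Rook)); (rook_home c w, None)])
       | w <- wings & every (vacant b) (between (king_home c) (rook_home c w))]
  else [::].

Definition piece_effects (c : color) (b : grid) (k : kind) (s : square) :
    seq effect :=
  [seq (s, x.2, (c, k), [::])
     | x <- lookup [::] (range_table k) s
     & if every (vacant b) x.1 then ~~ owned b x.2 c else false].

Definition effects_from (c : color) (b : grid) (s : square) : seq effect :=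
  if cell b s is Some (d, k) then
    if same_color c d then
      match k with
      | Pawn => pawn_effects c b s
      | King => piece_effects c b King s ++ castling_effects c b s
      | _ => piece_effects c b k s
      end
    else [::]
  else [::].

(* Castling and en passant captures are included even when attacks on the king's
   way or the history of the game forbid them. *)
Definition effects (c : color) (b : grid) : seq effect :=
  flatten [seq effects_from c b s | s <- squares].

(** * Every legal move is among the enumerated effects *)

Lemma attacksE b s t c k : b s = Some (c, k) -> k != Pawn ->
  attacks b s t =
    geometry k s t && all (fun u => b u == None) (crossed k s t).
Proof. by rewrite /attacks => ->; case: k => //= _; rewrite ?andbT. Qed.

Lemma all_vacant b B us :
  B =1 cell b -> all (fun u => B u == None) us = every (vacant b) us.
Proof. by move=> eqB; rewrite everyE; apply: eq_all => u; rewrite eqB vacantE. Qed.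

Lemma owner_ext b B s c :
  B =1 cell b -> (owner B s == Some c) = owned b s c.
Proof. by move=> eqB; rewrite ownedE /owner eqB. Qed.

(** Castling shifts the king by two files, too far for a king step. *)
Lemma castles_far w p s t k :
  castles w p (Move s t k) -> geometry King s t = false.
Proof.
case/and3P=> _ /eqP-> /eqP->; rewrite /king_home /king_dest /geometry /=.
by rewrite /gap subnn maxn0; case: w.
Qed.

Lemma no_castling p s t k :
  men p s != Some (mover p, King) \/ geometry King s t ->
  [seq w <- wings | castles w p (Move s t k)] = [::].
Proof.
move=> not_castle; have no w : castles w p (Move s t k) = false.
  apply/negP=> cst; case: not_castle => [/negP[] | ].
    by case/and3P: cst.
  by rewrite (castles_far cst).
by rewrite (eq_filter no) filter_pred0.
Qed.

Lemma board_after_plain p s t l c k u :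
    men p s = Some (c, k) -> mover p = c ->
    en_passant p (Move s t l) = false -> k != King \/ geometry King s t ->
  board_after p (Move s t l) u =
    if u == t then Some (c, odflt k l) else if u == s then None else men p u.
Proof.
move=> s_k c_p not_ep not_castle; rewrite /board_after not_ep no_castling /=.
  by rewrite orbF s_k c_p; case: (l).
case: not_castle => [not_king | ]; [left | by right].
by rewrite s_k c_p; apply: contra not_king => /eqP[->].
Qed.

Lemma not_pawn_no_en_passant p s t l c k :
  men p s = Some (c, k) -> k != Pawn -> en_passant p (Move s t l) = false.
Proof.
move=> s_k not_pawn; rewrite /en_passant s_k; apply/negP=> /and5P[/eqP[_ k_pawn]].
by rewrite k_pawn in not_pawn.
Qed.

Lemma no_promotion p s t l c k :
  men p s = Some (c, k) -> k != Pawn -> promotion_ok p (Move s t l) -> l = None.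
Proof.
move=> s_k not_pawn; rewrite /promotion_ok /= s_k; case: ifP => [|_ /eqP //].
by case/andP=> /eqP[_ k_pawn]; rewrite k_pawn in not_pawn.
Qed.

Lemma mem_effects c b s e :
  on_board s -> e \in effects_from c b s -> e \in effects c b.
Proof.
move=> on_s in_e; apply/flattenP; exists (effects_from c b s) => //.
by apply: map_f; rewrite mem_squares.
Qed.

Lemma mem_wings (T : eqType) (F : wing -> T) (P : pred wing) w :
  P w -> F w \in [seq F w' | w' <- wings & P w'].
Proof.
by case: w => /= ->; last case: (P _); rewrite /= !inE eqxx ?orbT.
Qed.

Lemma has_wings (P : pred wing) : has P wings -> exists w, P w.
Proof. by rewrite /= orbF => /orP[]; [exists Kingside | exists Queenside]. Qed.

Section Completeness.

Variables (p : position) (b : grid).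
Hypothesis men_b : men p =1 cell b.

Let c := mover p.

Definition matches (m : move) (e : effect) : Prop :=
  [/\ e.1.1.1 = src m, e.1.1.2 = dst m
    & board_after p m =1 cell (apply_effect b e)].

Lemma piece_complete s t l k : on_board s -> on_board t ->
    men p s = Some (c, k) -> k != Pawn -> promotion_ok p (Move s t l) ->
    attacks (men p) s t -> owner (men p) t != Some c ->
  exists2 e, e \in piece_effects c b k s & matches (Move s t l) e.
Proof.
move=> on_s on_t s_k not_pawn ok_l att not_own.
have l_none : l = None := no_promotion s_k not_pawn ok_l.
move: att; rewrite (attacksE _ s_k not_pawn) => /andP[geo vac].
exists (s, t, (c, k), [::]).
  apply/mapP; exists (crossed k s t, t) => //; rewrite mem_filter mem_range // andbT /=.
  by rewrite -(all_vacant _ men_b) vac -(owner_ext _ _ men_b).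
split=> // u; rewrite (board_after_plain _ s_k) //=.
- by rewrite l_none !cell_put men_b.
- exact: not_pawn_no_en_passant s_k not_pawn.
- by case: eqP geo => [-> | ] //; [right | left].
Qed.

Lemma castling_complete w s t l : men p s = Some (c, King) ->
    promotion_ok p (Move s t l) -> castles w p (Move s t l) -> castling_ok p w ->
  exists2 e, e \in castling_effects c b s & matches (Move s t l) e.
Proof.
move=> s_k ok_l cst ok_c.
have l_none : l = None := no_promotion s_k isT ok_l.
case/and3P: (cst) => _ /eqP s_home /eqP t_dest.
case/and3P: ok_c => _ vac _.
exists (s, t, (c, King), [:: (rook_dest c w, Some (c, Rook)); (rook_home c w, None)]).
  rewrite /castling_effects same_squareE s_home eqxx t_dest.
  apply: (mem_wings (fun w' => (_, king_dest c w', _, _))).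
  by rewrite -(all_vacant _ men_b).
have castE w' : castles w' p (Move s t l) = (king_dest c w == king_dest c w').
  by rewrite /castles s_k s_home t_dest !eqxx.
(* The two king destinations differ, so exactly one wing passes the filter. *)
have castled : ohead [seq w' <- wings | castles w' p (Move s t l)] = Some w.
  by rewrite (eq_filter castE); case: (w); rewrite /king_dest; case: c.
split=> // u; rewrite /board_after castled.
rewrite (not_pawn_no_en_passant _ _ s_k) // l_none s_k orbF /= !cell_put -men_b.
by case: (u == t); case: (u == s).
Qed.

Lemma pawn_complete s t l : on_board s -> on_board t ->
    men p s = Some (c, Pawn) -> promotion_ok p (Move s t l) ->
    [|| pawn_advance p (Move s t l),
        attacks (men p) s t && (owner (men p) t == Some (opp c))
      | en_passant p (Move s t l)] ->
  exists2 e, e \in pawn_effects c b s & matches (Move s t l) e.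
Proof.
move=> on_s on_t s_k ok_l leg.
have placed : odflt Pawn l \in placed_kinds c t.
  move: ok_l; rewrite /promotion_ok /placed_kinds /= s_k eqxx /=.
  by case: ifP => _; [rewrite !inE => /or4P[] /eqP-> | move/eqP->].
have attE : attacks (men p) s t = strikes c s t by rewrite /attacks s_k.
(* En passant is treated first, being the only pawn move that changes a third square. *)
case ep: (en_passant p (Move s t l)) leg => leg.
  case/and5P: ep (ep) => _; rewrite attE => att t_none _ victim ep.
  exists (s, t, (c, odflt Pawn l), [:: ((t.1, s.2), None)]).
    rewrite mem_cat; apply/orP; right; apply/flattenP; eexists.
      by apply: map_f (mem_strike on_s on_t att).
    rewrite ownedE vacantE holdsE -!men_b t_none victim /=.
    rewrite /owner -men_b (eqP t_none) /=.
    by apply/mapP; exists (odflt Pawn l).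
  split=> // u; rewrite /board_after ep no_castling; last by left; rewrite s_k; apply/eqP=> -[].
  rewrite /= !cell_put -men_b s_k; case: ifP => _; first by case: (l).
  by case: (u == s).
have {leg} leg : pushes c s t /\ every (vacant b) (between s t) /\ vacant b t
    \/ strikes c s t /\ owned b t (opp c).
  case/or3P: leg => [/and4P[same_file vac t_none fwd] | | //].
    left; rewrite /pushes same_file fwd vacantE -men_b t_none.
    by rewrite -(all_vacant _ men_b).
  by rewrite attE (owner_ext _ _ men_b) => /andP[]; right.
exists (s, t, (c, odflt Pawn l), [::]).
  rewrite mem_cat; case: leg => [[push_c [vac t_none]] | [strike_c foe]].
    apply/orP; left; apply/flattenP; eexists.
      by apply: map_f (mem_push on_s on_t push_c).
    by rewrite /= t_none vac; apply/mapP; exists (odflt Pawn l).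
  apply/orP; right; apply/flattenP; eexists.
    by apply: map_f (mem_strike on_s on_t strike_c).
  by rewrite foe; apply/mapP; exists (odflt Pawn l).
split=> // u; rewrite (board_after_plain _ s_k) //=; last by left.
by rewrite !cell_put men_b.
Qed.

(** Soundness rests on this inclusion: surplus effects only widen the opponent's choice. *)
Lemma effects_complete m : legal p m ->
  exists2 e, e \in effects c b & matches m e.
Proof.
case: m => s t l /and5P[on_s on_t s_own ok_l].
case s_k: (men p s) s_own => [[d k]|]; rewrite /owner s_k //= => /eqP[dE].
rewrite {d}dE in s_k *; have cell_s : cell b s = Some (c, k) by rewrite -men_b.
suff from_s : (match k with
    | Pawn => [|| pawn_advance p (Move s t l),
        attacks (men p) s t && (owner (men p) t == Some (opp c))
      | en_passant p (Move s t l)]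
    | King => attacks (men p) s t && (owner (men p) t != Some c)
        || has (fun w => castles w p (Move s t l) && castling_ok p w) wings
    | _ => attacks (men p) s t && (owner (men p) t != Some c) end) ->
    exists2 e, e \in effects_from c b s & matches (Move s t l) e.
  move=> leg; have [|e in_e m_e] := from_s; first by case: k {s_k cell_s from_s} leg.
  by exists e => //; apply: mem_effects on_s in_e.
rewrite /effects_from cell_s same_colorE eqxx.
have plain : k != Pawn -> attacks (men p) s t && (owner (men p) t != Some c) ->
    exists2 e, e \in piece_effects c b k s & matches (Move s t l) e.
  by move=> not_pawn /andP[att not_own]; apply: piece_complete s_k not_pawn ok_l _ _.
case: k s_k cell_s plain => s_k cell_s plain; try exact: plain.
- exact: pawn_complete.
- case/orP=> [/plain[// | e in_e m_e] | /has_wings[w /andP[cst ok_c]]].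
    by exists e; rewrite // mem_cat in_e.
  have [e in_e m_e] := castling_complete s_k ok_l cst ok_c.
  by exists e; rewrite // mem_cat in_e orbT.
Qed.

End Completeness.

(** A bound on where a king may stand, not a claim that it is there, hence still valid after its
    capture. Promotion never creates a king. *)
Lemma king_unique p m d s0 : legal p m ->
    (forall s, men p s = Some (d, King) -> s = s0) ->
  forall u, board_after p m u = Some (d, King) ->
    u = if src m == s0 then dst m else s0.
Proof.
case: m => s t l /and5P[_ _ _ ok_l _] uniq u.
rewrite /board_after; case: eqP => [-> | _].
  case: l ok_l => [l|] ok_l; last by move/uniq->; rewrite eqxx.
  by case=> _ lE; move/promotion_code: ok_l; rewrite /= lE.
case: ifP => // /negbT; rewrite negb_or => /andP[/eqP u_s _].
have keep : men p u = Some (d, King) -> u = (if s == s0 then t else s0).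
  by move/uniq=> u0; case: eqP => // s_s0; rewrite s_s0 u0 in u_s.
case: (ohead _) => [w|] //=.
by case: ifP => // _; case: ifP.
Qed.

(** * Steps of a plan and repetition of positions *)

(* [free_squares] are the squares that must be empty: those jumped over and, for
   a pawn push, the destination. *)
Record step := Step {
  stepper : kind; from : square; to : square;
  free_squares : seq square; takes : bool }.

Definition step_move (x : step) : move := Move (from x) (to x) None.

(** What can be checked without a board, once per list of plans. No step promotes, and [takes] marks
    pawn captures alone. *)
Definition well_formed (c : color) (x : step) : bool :=
  let: Step k s t us tk := x in
  [&& on_board s, on_board t
    & if k is Pawn then
        (t.2 != home_rank (opp c))
        && (if tk then strikes c s t else pushes c s t && (us == t :: between s t))
      else [&& ~~ tk, geometry k s t & us == crossed k s t]].

Definition fits (c : color) (b : grid) (x : step) : bool :=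
  let: Step k s t us tk := x in
  if holds b s c k then
    if every (vacant b) us then
      if tk then owned b t (opp c) else ~~ owned b t c
    else false
  else false.

Definition step_grid (c : color) (b : grid) (x : step) : grid :=
  put (put b (from x) None) (to x) (Some (c, stepper x)).

Lemma fits_legal p b x : men p =1 cell b ->
    well_formed (mover p) x -> fits (mover p) b x ->
  legal p (step_move x)
  /\ board_after p (step_move x) =1 cell (step_grid (mover p) b x).
Proof.
set c := mover p => men_b; case: x => k s t us tk /= /and3P[on_s on_t wf].
case s_k: (holds b s c k) => //; case vac: (every (vacant b) us) => // t_ok.
have {}s_k : men p s = Some (c, k) by apply/eqP; rewrite men_b -holdsE.
have s_own : owner (men p) s == Some c by rewrite /owner s_k.
rewrite /step_move /=.
have promo : promotion_ok p (Move s t None).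
  rewrite /promotion_ok /= s_k; case: ifP => // /andP[/eqP[k_pawn] last_rank].
  by move: wf; rewrite k_pawn last_rank.
have gridE : en_passant p (Move s t None) = false ->
    k != King \/ geometry King s t ->
    board_after p (Move s t None) =1 cell (step_grid c b (Step k s t us tk)).
  move=> no_ep not_castle u; rewrite (board_after_plain _ s_k) //.
  by rewrite !cell_put men_b.
have t_foe : tk -> owner (men p) t = Some (opp c).
  by move=> tkT; apply/eqP; rewrite (owner_ext _ _ men_b); rewrite tkT in t_ok.
have [k_pawn | not_pawn] := eqVneq k Pawn.
  rewrite {k}k_pawn in s_k wf gridE *; case/andP: wf => _ wf.
  have attE : attacks (men p) s t = strikes c s t by rewrite /attacks s_k.
  split; last first.
    apply: gridE => //; last by left.
    (* Neither pawn step is an en passant capture: a strike finds a man on [t], a push keeps its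
       file. *)
    apply/negP=> /and5P[_]; rewrite attE => /andP[/eqP one_file _] /eqP t_none _ _.
    case: tk wf t_foe t_ok => [_ /(_ isT)|/andP[/andP[/eqP same_file _] _] _ _].
      by rewrite /owner t_none.
    by move: one_file; rewrite same_file /gap subnn.
  apply/and5P; split=> //; rewrite s_k; apply/or3P.
  case: tk wf t_foe {t_ok gridE} => [strike_c /(_ isT) t_foe | ].
    by apply: Or32; rewrite attE strike_c t_foe eqxx.
  case/andP=> /andP[same_file fwd] /eqP usE _; apply: Or31.
  move: vac; rewrite usE /= vacantE -men_b.
  case: eqP => // t_none; rewrite -(all_vacant _ men_b) => vac.
  by apply/and4P; split=> //; apply/eqP.
have /and3P[/negPf not_tk geo /eqP usE] :
    [&& ~~ tk, geometry k s t & us == crossed k s t].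
  by case: k wf not_pawn {s_k gridE promo}.
rewrite not_tk in t_ok.
have plain : attacks (men p) s t && (owner (men p) t != Some c).
  by rewrite (attacksE _ s_k not_pawn) geo -usE (all_vacant _ men_b) vac
             (owner_ext _ _ men_b).
split; last first.
  apply: gridE => //; first exact: not_pawn_no_en_passant s_k not_pawn.
  by case: (eqVneq k King) geo => [-> | ]; [right | left].
apply/and5P; split=> //; rewrite s_k.
by case: k not_pawn {s_k geo usE wf gridE} => // _; rewrite plain.
Qed.

(** * Turn clock and threefold repetition *)

Section Slots.

Variables i j : nat.
Hypotheses (i_gt0 : 0 < i) (j_gt0 : 0 < j).

(** The number of single moves already made in the current round, a white turn followed by a black
    one. *)
Definition slot (p : position) : nat :=
  if mover p is White then i - moves_left p else i + (j - moves_left p).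

(* The side to move and the number of its remaining moves recur with period
   [i + j] in the number of moves played. *)
Definition clocked (g : game) : Prop :=
  0 < moves_left (current g) <= quota i j (mover (current g))
  /\ [seq slot q | q <- current g :: past g]
     = [seq n %% (i + j) | n <- rev (iota 0 (size (past g)).+1)].

Lemma rev_iotaS n : rev (iota 0 n.+1) = n :: rev (iota 0 n).
Proof. by rewrite -addn1 iotaD rev_cat. Qed.

Lemma quota_gt0 c : 0 < quota i j c.
Proof. by case: c. Qed.

Lemma slot_after p m : 0 < moves_left p <= quota i j (mover p) ->
  slot (position_after i j p m) = (slot p).+1 %% (i + j).
Proof.
case: m => s t l; rewrite /slot /position_after /=.
case: (mover p) (moves_left p) => -[|[|k]] //= lt_k.
(* In order: the last move of a white turn, an earlier white move, the last move of a black turn, an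
   earlier black move. *)
- by rewrite subnn addn0 subn1 prednK // modn_small // -addn1 leq_add2l.
- rewrite subnSK // modn_small //; apply: leq_ltn_trans (leq_subr _ _) _.
  by rewrite -[X in X < _]addn0 ltn_add2l.
- by rewrite subn1 subnn -addnS prednK // modnn.
- rewrite -addnS subnSK // modn_small //.
  by rewrite ltn_add2l ltn_subrL.
Qed.

Lemma clocked_play g m : clocked g -> clocked (play i j g m).
Proof.
case=> ml slots; split; last first.
  rewrite [current _]/= [past _]/= [size _]/= map_cons slots slot_after //.
  rewrite [in RHS]rev_iotaS map_cons; congr (_ :: _).
  have -> : slot (current g) = size (past g) %% (i + j).
    by move: slots; rewrite rev_iotaS !map_cons => -[].
  by rewrite -addn1 modnDml addn1.
case: m => s t l; rewrite /= /position_after /=.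
case: (leqP (moves_left _) 1) => [_ | lt1]; first by case: (mover _) => /=; apply/andP.
by case: (moves_left _) ml lt1 => [|k] //= lt_k; rewrite ltnS => ->; apply: ltnW.
Qed.

(** Below two periods the only smaller index that can be congruent to [N] is [N - (i + j)]. *)
Lemma count_modn N : N < 2 * (i + j) ->
  count (fun n => n %% (i + j) == N %% (i + j)) (iota 0 N) <= 1.
Proof.
move=> lt_N; set P := fun n => _.
have sub : {in iota 0 N, forall n, P n -> n == N - (i + j)}.
  move=> n; rewrite mem_iota /= add0n => lt_n.
  rewrite /P eq_sym eqn_mod_dvd ?(ltnW lt_n) // => /dvdnP[q qE].
  have q_gt0 : 0 < q by case: q qE => // /eqP; rewrite subn_eq0 leqNgt lt_n.
  have lt_q : q < 2.
    rewrite -(ltn_pmul2r (_ : 0 < i + j)) ?addn_gt0 ?i_gt0 // -qE.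
    exact: leq_ltn_trans (leq_subr _ _) lt_N.
  have q1 : q = 1 by apply/eqP; rewrite eqn_leq -ltnS lt_q.
  by rewrite -[i + j]mul1n -q1 -qE subKn // ltnW.
apply: leq_trans (_ : count_mem (N - (i + j)) (iota 0 N) <= 1); last first.
  by rewrite count_uniq_mem ?iota_uniq // leq_b1.
rewrite -!size_filter; apply: uniq_leq_size; first by rewrite filter_uniq ?iota_uniq.
by move=> n; rewrite !mem_filter => /andP[P_n in_n]; rewrite in_n andbT; apply: sub.
Qed.

(** Occurrences of a position share their slot, hence lie whole rounds apart; a third one needs two
    full rounds before it. *)
Lemma clocked_fresh g : clocked g -> size (past g) < 2 * (i + j) ->
  ~~ threefold_repetition g.
Proof.
case=> _ slots lt_g; rewrite /threefold_repetition -ltnNge ltnS.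
move: slots; rewrite rev_iotaS !map_cons => -[slot_g slots].
apply: leq_trans (_ : count (fun q => slot q == slot (current g)) (past g) <= 1).
  apply: sub_count => q /and5P[_ _ _ /eqP mE /eqP lE].
  by rewrite /slot mE lE.
rewrite -(count_map slot (pred1 (slot (current g)))) slots slot_g count_map count_rev.
exact: count_modn.
Qed.

End Slots.

(** * The search and its soundness *)

Record state := State {
  layout : grid; foe_king : square; own_king : square; seen : seq grid }.

(** Coarser than [same_position], as rights and clock are ignored, so repetitions are at worst
    overcounted. *)
Definition same_grid (b b' : grid) : bool :=
  every (fun s => cell b s == cell b' s) squares.

Section Checker.

(* [c] is the side to win, [spare] a list of moves one of which the opponent is
   expected to have, so as not to be stalemated, and [foe_quota] the length of
   the opponent's turns.  Positions reached after less than [grace] moves need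
   not be compared with their predecessors. *)
Variables (c : color) (grace foe_quota : nat).
Variables (spare : seq step) (mates replies : seq (seq step)).

Definition make_step (st : state) (x : step) : state :=
  State (step_grid c (layout st) x) (foe_king st)
    (if same_square (from x) (own_king st) then to x else own_king st)
    (layout st :: seen st).

(** [own_king] stays as it is: if the king is captured there, [safe] fails. *)
Definition suffer (st : state) (e : effect) : state :=
  State (apply_effect (layout st) e)
    (if same_square e.1.1.1 (foe_king st) then e.1.1.2 else foe_king st)
    (own_king st) (layout st :: seen st).

(** Excludes defeat and every draw but stalemate. With fewer than 50 single moves played, the
    fifty-move rule is out of reach. *)
Definition safe (st : state) : bool :=
  if holds (layout st) (own_king st) c King then
    if size (seen st) < grace then true
    else if size (seen st) < 50
    then count (same_grid (layout st)) (seen st) < 2 else false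
  else false.

(** Arrival on [foe_king] ends the plan with success: a living enemy king can stand nowhere else. *)
Fixpoint execute (st : state) (plan : seq step) (goal : pred state) : bool :=
  if plan is x :: plan' then
    if fits c (layout st) x then
      if same_square (to x) (foe_king st) then true
      else let st' := make_step st x in
           if safe st' then execute st' plan' goal else false
    else false
  else goal st.

(** A fitting spare step certifies that the opponent has a legal move, which the generous list of
    effects cannot do. *)
Fixpoint survive (k : nat) (st : state) (goal : pred state) : bool :=
  if safe st then
    if k is k'.+1 then
      if any (fits (opp c) (layout st)) spare then
        every (fun e => survive k' (suffer st e) goal)
              (effects (opp c) (layout st))
      else false
    else goal st
  else false.

(** A cheap filter: with goal [pred0] a plan succeeds only by reaching [foe_king]. *)
Definition captures (st : state) (plan : seq step) : bool :=
  if any (fun x => same_square (to x) (foe_king st)) plan then execute st plan pred0 else false.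

Fixpoint wins (n : nat) (st : state) : bool :=
  if any (captures st) mates then true
  else if n is n'.+1 then
    any (fun plan => execute st plan
                        (fun st' => survive foe_quota st' (wins n'))) replies
  else false.

End Checker.

Definition initial_state (c : color) : state :=
  State (tabulate initial_board) (king_home (opp c)) (king_home c) [::].

Lemma has_all T (P Q : pred T) s :
  has P s -> all Q s -> exists x, P x /\ Q x.
Proof.
elim: s => //= x s IHs /orP[P_x | has_P] /andP[Q_x all_Q]; first by exists x.
exact: IHs.
Qed.

(** * Soundness: a successful search yields a forced win *)

Section Soundness.

Variables (i j : nat) (c : color) (grace : nat).
Hypotheses (i_gt0 : 0 < i) (j_gt0 : 0 < j).
Hypotheses (le_grace : grace <= 2 * (i + j)) (lt_grace : grace < 50).

Fixpoint tracks (ps : seq position) (bs : seq grid) : Prop :=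
  match ps, bs with
  | [::], [::] => True
  | p :: ps', b :: bs' => men p =1 cell b /\ tracks ps' bs'
  | _, _ => False
  end.

Lemma tracks_size ps bs : tracks ps bs -> size ps = size bs.
Proof. by elim: ps bs => [|p ps IHps] [|b bs] //= [_ /IHps->]. Qed.

Lemma same_gridP (p q : position) b b' : men p =1 cell b -> men q =1 cell b' ->
  same_position p q -> same_grid b b'.
Proof.
move=> men_b men_b' /and5P[/allP eq_pq _ _ _ _].
rewrite /same_grid everyE; apply/allP=> s /eq_pq.
by rewrite men_b men_b'.
Qed.

Lemma tracks_count p b ps bs : men p =1 cell b -> tracks ps bs ->
  count (same_position p) ps <= count (same_grid b) bs.
Proof.
move=> men_b; elim: ps bs => [|q ps IHps] [|b' bs] //= [men_b' /IHps le_bs].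
by apply: leq_add le_bs; case E: same_position => //; rewrite (same_gridP _ _ E).
Qed.

Record describes (st : state) (g : game) : Prop := Describes {
  describes_men : men (current g) =1 cell (layout st);
  describes_foe : forall s,
    men (current g) s = Some (opp c, King) -> s = foe_king st;
  describes_own : on_board (own_king st);
  describes_past : tracks (past g) (seen st);
  describes_clock : clocked i j g;
  describes_quiet : quiet g White + quiet g Black <= size (past g) }.

Lemma own_king_alive st g : describes st g ->
    holds (layout st) (own_king st) c King ->
  king_captured (men (current g)) c = false.
Proof.
case=> men_b _ on_k _ _ _ own_k.
apply/negbTE; rewrite negbK; apply/hasP; exists (own_king st).
  by rewrite mem_squares.
by rewrite men_b -holdsE.
Qed.

Lemma status_won st g : describes st g ->
    holds (layout st) (own_king st) c King ->
  king_captured (men (current g)) (opp c) -> status_of g = Won c.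
Proof.
move=> desc /(own_king_alive desc) alive dead.
by move: dead alive; rewrite /status_of; case: (c) => /= -> // ->.
Qed.

Lemma safe_own_king st :
  safe c grace st -> holds (layout st) (own_king st) c King.
Proof. by rewrite /safe; case: ifP. Qed.

Lemma status_safe st g : describes st g -> safe c grace st ->
  can_move (current g) -> status_of g = Won c \/ status_of g = Ongoing.
Proof.
move=> desc ok_st moves.
case foe_dead: (king_captured (men (current g)) (opp c)).
  by left; apply: status_won desc (safe_own_king ok_st) foe_dead.
right; have own_alive := own_king_alive desc (safe_own_king ok_st).
case: desc ok_st => men_b _ on_k past_g clock_g quiet_g; rewrite /safe.
case: ifP => // _ fresh.
have lt50 : size (past g) < 50.
  rewrite (tracks_size past_g); case: ltnP fresh => [lt_g _|_].
    exact: ltn_trans lt_grace.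
  by case: ifP.
have not_fifty : fifty_moves g = false.
  apply/negP=> /andP[le_w le_b]; have := leq_trans (leq_add le_w le_b) quiet_g.
  by rewrite leqNgt (leq_trans lt50).
have not_rep : threefold_repetition g = false.
  apply/negbTE; case: ltnP fresh => [lt_g _ | _].
    apply: clocked_fresh clock_g _ => //; rewrite (tracks_size past_g).
    exact: leq_trans le_grace.
  case: ifP => // _ lt2; rewrite /threefold_repetition -ltnNge.
  exact: leq_ltn_trans (tracks_count men_b past_g) lt2.
rewrite /status_of moves not_fifty not_rep /=.
by move: foe_dead own_alive; case: (c) => /= -> ->.
Qed.

Lemma describes_play st st' g m :
    describes st g ->
    board_after (current g) m =1 cell (layout st') ->
    (forall s, board_after (current g) m s = Some (opp c, King) ->
       s = foe_king st') ->
    on_board (own_king st') -> seen st' = layout st :: seen st ->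
  describes st' (play i j g m).
Proof.
case=> men_b _ _ past_g clock_g quiet_g men_b' foe_k' own_k' seen_st'.
have menE : men (current (play i j g m)) = board_after (current g) m.
  by case: (m).
split; rewrite ?menE //; first by rewrite seen_st'.
  exact: clocked_play.
rewrite /=; case: ifP => _; first by [].
(* Exactly one of the two counters grows, by one, and so does the past. *)
rewrite addnACA; apply: leq_trans (leq_add quiet_g (leqnn _)) _.
by rewrite addnC; case: (mover _).
Qed.

Lemma mover_play g m : mover (current (play i j g m)) =
  if moves_left (current g) <= 1 then opp (mover (current g))
  else mover (current g).
Proof. by case: m. Qed.

Lemma moves_left_play g m : moves_left (current (play i j g m)) =
  if moves_left (current g) <= 1 then quota i j (opp (mover (current g)))
  else (moves_left (current g)).-1.
Proof. by case: m. Qed.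

(** Having no moves left is identified with the start of the other side's turn, so that one index
    runs down a whole turn. *)
Definition turn (d : color) (k : nat) (g : game) : Prop :=
  if k is 0 then mover (current g) = opp d
                 /\ moves_left (current g) = quota i j (opp d)
  else mover (current g) = d /\ moves_left (current g) = k.

Lemma turn_play d k g m : turn d k.+1 g -> turn d k (play i j g m).
Proof.
rewrite /turn mover_play moves_left_play => -[-> ->].
by case: k.
Qed.

Lemma make_step_play st g x :
    describes st g -> mover (current g) = c -> well_formed c x ->
    fits c (layout st) x ->
  legal (current g) (step_move x)
  /\ describes (make_step c st x) (play i j g (step_move x)).
Proof.
move=> desc c_g wf fit_x; have [men_b foe_k on_k _ _ _] := desc.
have [leg men_b'] : legal (current g) (step_move x)
    /\ board_after (current g) (step_move x) =1 cell (step_grid c (layout st) x).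
  by rewrite -[in step_grid _]c_g; apply: fits_legal; rewrite ?c_g.
split=> //; apply: (describes_play (st' := make_step c st x) desc men_b') => //.
  move=> s; rewrite men_b' !cell_put; case: eqP => _ //.
    by case=> c_opp; move: (opp_neq c); rewrite -c_opp eqxx.
  by case: eqP => // _; rewrite -men_b; apply: foe_k.
by rewrite /=; case: ifP => // _; case: x wf {fit_x leg men_b'} => k s t us tk /and3P[].
Qed.

Lemma make_step_own_king st x : well_formed c x -> fits c (layout st) x ->
    holds (layout st) (own_king st) c King ->
  holds (layout (make_step c st x)) (own_king (make_step c st x)) c King.
Proof.
case: x => k s t us tk _ /=.
case s_k: (holds _ s c k) => //; case: (every _ _) => // t_ok own_k.
rewrite /step_grid same_squareE /=.
have [s_own | s_own] := eqVneq s (own_king st).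
  by move: s_k own_k; rewrite -s_own !holdsE !cell_put eqxx => /eqP-> /eqP[->].
move: own_k; rewrite !holdsE !cell_put => /eqP own_k.
have [own_t | _] := eqVneq (own_king st) t.
  by move: t_ok; rewrite -own_t !ownedE /owner own_k; case: (tk); case: (c).
by rewrite (eq_sym _ s) (negPf s_own) own_k.
Qed.

(** After the step [foe_king], the only possible place of the enemy king, holds a man of [c]. *)
Lemma capture_wins st g x n :
    describes st g -> safe c grace st -> mover (current g) = c ->
    well_formed c x -> fits c (layout st) x -> to x = foe_king st ->
  forced i j c n.+1 g.
Proof.
move=> desc ok_st c_g wf fit_x to_x.
have [leg desc'] := make_step_play desc c_g wf fit_x.
have [won | on_g] := status_safe desc ok_st (legal_can_move leg).
  exact: forced_won.
apply: forced_choose on_g c_g leg _; apply: forced_won.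
apply: (status_won desc'); first by rewrite make_step_own_king ?safe_own_king.
apply/hasPn=> s _; apply/negP=> /eqP s_king.
have s_to := describes_foe desc' s_king; rewrite /= -to_x in s_to.
move: s_king; rewrite (describes_men desc') s_to cell_put eqxx.
by case=> c_opp; move: (opp_neq c); rewrite -c_opp eqxx.
Qed.

(** Covers both uses: a plan filling the turn may end in [goal], while a shorter one must capture
    the king, its goal being always false. *)
Lemma execute_forced n k st g plan (goal : pred state) :
    describes st g -> safe c grace st -> turn c k g ->
    size plan <= k -> 0 < k -> all (well_formed c) plan ->
    (size plan = k -> forall st' g', describes st' g' -> goal st' ->
       turn c 0 g' -> forced i j c n g') ->
    (size plan < k -> forall st', goal st' = false) ->
  execute c grace st plan goal -> forced i j c (size plan + n) g.
Proof.
elim: plan k st g => [|x plan IHplan] k st g desc ok_st.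
  by move=> _ _ k_gt0 _ _ no_goal; rewrite /= no_goal.
case: k => // k turn_g le_k _ /andP[wf_x wf_plan] goalP no_goal; rewrite [execute _ _ _ _ _]/=.
case fit_x: (fits _ _ _) => //; rewrite same_squareE.
have c_g : mover (current g) = c by case: turn_g.
case: eqP => [to_x _ | _]; first exact: capture_wins desc ok_st c_g wf_x fit_x to_x.
case: ifP => // ok_st'.
have [leg desc'] := make_step_play desc c_g wf_x fit_x.
have [won | on_g] := status_safe desc ok_st (legal_can_move leg).
  by move=> _; apply: forced_won.
move=> exec; apply: forced_choose on_g c_g leg _.
have turn' := turn_play (step_move x) turn_g.
case: k le_k turn' goalP no_goal {turn_g} => [|k] le_k turn' goalP no_goal.
  case: plan le_k exec goalP {IHplan wf_plan no_goal} => //= _ exec goalP.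
  exact: goalP exec turn'.
apply: (IHplan k.+1) exec => //.
by move=> eq_k; apply: goalP; rewrite /= eq_k.
Qed.

Lemma captures_execute st plan :
  captures c grace st plan -> execute c grace st plan pred0.
Proof. by rewrite /captures; case: ifP. Qed.

Lemma survive_forced n k st g spare (goal : pred state) :
    describes st g -> turn (opp c) k g -> all (well_formed (opp c)) spare ->
    (forall st' g', describes st' g' -> safe c grace st' -> goal st' ->
       turn (opp c) 0 g' -> forced i j c n g') ->
  survive c grace spare k st goal -> forced i j c (k + n) g.
Proof.
move=> desc turn_g wf_spare goalP; elim: k st g desc turn_g => [|k IHk] st g desc turn_g;
  rewrite [survive _ _ _ _ _ _]/=.
  by case: ifP => // ok_st goal_st; apply: goalP desc ok_st goal_st turn_g.
case: ifP => // ok_st; rewrite anyE everyE; case: ifP => // movable /allP surv.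
have [x [fit_x wf_x]] := has_all movable wf_spare.
have [o_g _] := turn_g.
have leg : legal (current g) (step_move x).
  by case: (fits_legal (x := x) (describes_men desc)); rewrite ?o_g.
have [won | on_g] := status_safe desc ok_st (legal_can_move leg).
  exact: forced_won.
apply: (forced_respond on_g o_g) => m leg_m.
have [e in_e [src_e dst_e men_e]] := effects_complete (describes_men desc) leg_m.
rewrite o_g in in_e; apply: IHk (surv e in_e); last exact: turn_play.
apply: (describes_play (st' := suffer st e) desc men_e) => //; last exact: describes_own desc.
by rewrite /= same_squareE src_e dst_e; apply: king_unique leg_m (describes_foe desc).
Qed.

(** Each round costs both quotas, the final turn only that of [c]. The condition [turn (opp c) 0]
    says that [c] begins a turn. *)
Lemma wins_forced spare mates replies n st g :
    all (well_formed (opp c)) spare ->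
    all (fun plan => all (well_formed c) plan && (size plan <= quota i j c))
      mates ->
    all (fun plan => all (well_formed c) plan && (size plan == quota i j c))
      replies ->
    describes st g -> safe c grace st -> turn (opp c) 0 g ->
  wins c grace (quota i j (opp c)) spare mates replies n st ->
  forced i j c (n * (quota i j c + quota i j (opp c)) + quota i j c) g.
Proof.
move=> wf_spare ok_mates ok_replies.
have q_gt0 : 0 < quota i j c by case: (c).
have turn_c g' : turn (opp c) 0 g' -> turn c (quota i j c) g'.
  by rewrite /turn oppK; case: quota q_gt0.
elim: n st g => [|n IHn] st g desc ok_st /turn_c turn_g;
  rewrite [wins _ _ _ _ _ _ _ _]/= !anyE.
- case: ifP => // mate _.
  have [plan [/captures_execute exec /andP[wf_plan le_q]]] := has_all mate ok_mates.
  rewrite add0n -(subnKC le_q).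
  by apply: (execute_forced desc ok_st turn_g) exec.
case: ifP => [mate _|_].
  have [plan [/captures_execute exec /andP[wf_plan le_q]]] := has_all mate ok_mates.
  rewrite -(subnKC le_q) addnCA.
  by apply: (execute_forced desc ok_st turn_g) exec.
case/has_all/(_ ok_replies)=> plan [exec /andP[wf_plan /eqP eq_q]].
rewrite mulSn -!addnA -{1}eq_q.
apply: (execute_forced desc ok_st turn_g) exec => //.
- by rewrite eq_q.
- move=> _ st' g' desc' surv turn_g'.
  apply: survive_forced surv => //.
    by move: turn_g'; rewrite /turn; case: quota (quota_gt0 i_gt0 j_gt0 (opp c)).
  by move=> st'' g'' desc'' ok_st'' win_st'' turn_g''; apply: IHn win_st''.
- by rewrite eq_q ltnn.
Qed.

End Soundness.

(** * Winning plans *)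

Lemma initial_board_cell : initial_board =1 cell (tabulate initial_board).
Proof.
case=> f r; rewrite /cell /lookup.
by case: f => [|[|[|[|[|[|[|[|f]]]]]]]]; case: r => [|[|[|[|[|[|[|[|r]]]]]]]];
   rewrite /= ?nth_nil //; case: f.
Qed.

Lemma initial_king c s : initial_board s = Some (c, King) -> s = king_home c.
Proof.
case: s => f r; rewrite /initial_board /=.
by case: r => [|[|[|[|[|[|[|[|r]]]]]]]] //=;
   case: f => [|[|[|[|[|[|[|[|[|f]]]]]]]]] //= => -[<-].
Qed.

Section Initial.

Variables (i j : nat) (grace : nat) (n : nat).
Variables (spare : seq step) (mates replies : seq (seq step)).
Hypotheses (i_gt0 : 0 < i) (j_gt0 : 0 < j).
Hypotheses (le_grace : grace <= 2 * (i + j)) (lt_grace : grace < 50).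

Lemma describes_initial c :
  describes i j c (initial_state c) (initial_game i j).
Proof.
split=> //.
- exact: initial_board_cell.
- by move=> s /initial_king.
- by case: c.
- by split; rewrite /= ?leqnn ?i_gt0 // /slot /= subnn mod0n.
Qed.

Lemma white_wins :
    all (well_formed Black) spare ->
    all (fun plan => all (well_formed White) plan && (size plan <= i)) mates ->
    all (fun plan => all (well_formed White) plan && (size plan == i)) replies ->
    safe White grace (initial_state White) ->
    wins White grace j spare mates replies n (initial_state White) ->
  has_winning_strategy i j White.
Proof.
move=> wf_spare wf_mates wf_replies ok_init win_init.
apply: forced_has_winning_strategy.
exact: (wins_forced i_gt0 j_gt0 le_grace lt_grace (c := White)
          wf_spare wf_mates wf_replies (describes_initial White) ok_init _ win_init).
Qed.

(** White's opening turn is absorbed by [survive], after which Black begins a turn as [wins_forced]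
    requires. *)
Lemma black_wins :
    all (well_formed White) spare ->
    all (fun plan => all (well_formed Black) plan && (size plan <= j)) mates ->
    all (fun plan => all (well_formed Black) plan && (size plan == j)) replies ->
    survive Black grace spare i (initial_state Black)
      (wins Black grace i spare mates replies n) ->
  has_winning_strategy i j Black.
Proof.
move=> wf_spare wf_mates wf_replies surv_init.
apply: forced_has_winning_strategy.
apply: (survive_forced i_gt0 j_gt0 le_grace lt_grace (c := Black)
          (describes_initial Black) _ wf_spare _ surv_init).
  by case: (i) i_gt0.
move=> st g desc ok_st win_st turn_g.
exact: (wins_forced i_gt0 j_gt0 le_grace lt_grace (c := Black)
          wf_spare wf_mates wf_replies desc ok_st turn_g win_st).
Qed.

End Initial.

(** * Reading plans from text *)

Definition read_kind (a : ascii) : kind :=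
  match a with
  | "N"%char => Knight | "B"%char => Bishop | "R"%char => Rook
  | "Q"%char => Queen | "K"%char => King | _ => Pawn
  end.

Definition read_square (file rank : ascii) : square :=
  (nat_of_ascii file - nat_of_ascii "a", nat_of_ascii rank - nat_of_ascii "1").

(* A pawn step takes exactly when it changes file; whether the step is geometrically
   possible is left to [well_formed]. *)
Definition make_plan_step (k : kind) (s t : square) : step :=
  let tk := (k == Pawn) && (s.1 != t.1) in
  let us := if k == Pawn then if tk then [::] else t :: between s t
            else crossed k s t in
  Step k s t us tk.

Fixpoint read_plan (w : string) : seq step :=
  match w with
  | String k (String f (String r (String f' (String r' w')))) =>
      make_plan_step (read_kind k) (read_square f r) (read_square f' r')
      :: (if w' is String _ w'' then read_plan w'' else [::])
  | _ => [::]
  end.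

(* The plans below were found by computer.  A [mates] list is searched for a
   capture of the king within the turn, a [replies] list for a turn after which
   the win can be repeated against every answer. *)
Local Open Scope string_scope.

Definition white_spare : seq step :=
  Eval vm_compute in read_plan "Nb1c3 Ng1f3 Nb1a3 Ng1h3 Nc3b1 Na3b1 Nf3g1 Nh3g1".

Definition black_spare : seq step :=
  Eval vm_compute in read_plan "Nb8c6 Ng8f6 Nb8a6 Ng8h6 Nc6b8 Na6b8".

Definition white4_mates : seq (seq step) :=
  Eval vm_compute in map read_plan [:: "Nb1c3 Nc3d5 Nd5c7 Nc7e8"].

Definition white21_mates : seq (seq step) :=
  Eval vm_compute in map read_plan [:: "Nd5c7 Nc7e8"].

Definition white21_replies : seq (seq step) :=
  Eval vm_compute in map read_plan [:: "Nb1c3 Nc3d5"].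

Definition white3_mates : seq (seq step) :=
  Eval vm_compute in map read_plan [::
  "Nc3b5 Nb5d6 Nd6e8";
  "Qf3f6 Qf6e7";
  "Qf3g4 Qg4d7";
  "Qf3h5 Qh5f7";
  "Qf3f7 Qf7f8";
  "Qf3g4 Qg4d7 Qd7d8";
  "Qf3f7 Qf7e8";
  "Qf3f5 Qf5d7";
  "Nc3d5 Nd5e7";
  "Qf3f7 Qf7d7";
  "Qf3g4 Qg4e6";
  "Qf3f6 Qf6d8";
  "Qf3f5 Qf5f7";
  "Qf3f6 Qf6f7";
  "Bf1b5 Bb5d7";
  "Pe4f5 Pf5e6";
  "Pe4f5 Pf5g6";
  "Pe4e5 Pe5f6";
  "Qf3h5 Qh5g6";
  "Qf3d3 Qd3d7 Qd7d8";
  "Pe4d5 Pd5c6";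
  "Pe4e5 Qf3c6"].

Definition white3_replies : seq (seq step) :=
  Eval vm_compute in map read_plan [:: "Pe2e4 Qd1f3 Nb1c3"].

Definition black4_mates : seq (seq step) :=
  Eval vm_compute in map read_plan [::
  "Nb8a6 Na6c5 Nc5d3 Nd3e1";
  "Nb8c6 Nc6d4 Nd4e2";
  "Ng8f6 Nf6e4 Ne4d2";
  "Ng8f6 Nf6e4 Ne4f2";
  "Ng8f6 Nf6d5 Nd5e3 Ne3f1";
  "Ng8f6 Nf6d5 Nd5c3 Nc3d1";
  "Nb8c6 Nc6e5 Ne5f3";
  "Ng8f6 Nf6e4 Ne4g3"].

Definition black13_mates : seq (seq step) :=
  Eval vm_compute in map read_plan [::
  "Nc6b4 Nb4d3 Nd3e1";
  "Pe7e5 Qd8h4 Qh4e1";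
  "Nc6d4 Nd4e2";
  "Pe7e5 Bf8b4 Bb4e1"].

Definition black13_replies : seq (seq step) :=
  Eval vm_compute in map read_plan [:: "Ng8f6 Rh8g8 Nb8c6"].

Definition black12_mates : seq (seq step) :=
  Eval vm_compute in map read_plan [::
  "Nc5d3 Nd3e1";
  "Qh4f2 Qf2e2";
  "Qh4f2 Qf2e1";
  "Nd4c2 Nc2e1";
  "Nc5e4 Ne4f2";
  "Qh4f2 Qf2f3";
  "Nc5b3 Nb3d2";
  "Qh4e4 Qe4e2";
  "Qh4f2 Qf2e3";
  "Qh4c4 Qc4e2";
  "Qh4b4 Qb4e1";
  "Qh4g5 Qg5d2"].

Definition black12_replies : seq (seq step) :=
  Eval vm_compute in map read_plan [:: "Nb8a6 Na6c5"; "Nb8c6 Nc6d4"; "Pe7e5 Qd8h4"].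

Definition black23_mates : seq (seq step) :=
  Eval vm_compute in map read_plan [::
  "Nc6b4 Nb4d3 Nd3e1";
  "Na6c5 Nc5d3 Nd3e1";
  "Nc6d4 Nd4e2";
  "Nd5b4 Nb4d3 Nd3e1";
  "Nf6d5 Nd5c3 Nc3d1";
  "Nf6d5 Nd5e3 Ne3f1";
  "Nf6e4 Ne4d2";
  "Nf6e4 Ne4f2";
  "Qd8a5 Qa5d2 Qd2e1";
  "Ne4d2 Nd2f3 Nf3e1";
  "Pd7c6 Qd8d2 Qd2e1";
  "Nf6d5 Nd5c3 Nc3e2";
  "Bf8b4 Bb4d2 Bd2e1";
  "Nc6e5 Ne5f3 Nf3g1";
  "Nb8c6 Nc6d4 Nd4e2";
  "Nd5e3 Ne3f1";
  "Ng4e3 Ne3d1";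
  "Pe7e5 Bf8b4 Bb4e1";
  "Qd8h4 Qh4f2 Qf2e1";
  "Nd5c3 Nc3d1";
  "Qd8b6 Qb6f2 Qf2e1";
  "Pe7e5 Qd8h4 Qh4e1";
  "Qd8b6 Qb6e3 Qe3e1";
  "Ng4e3 Ne3f1";
  "Qd8a5 Qa5c3 Qc3e1";
  "Ng8f6 Nf6e4 Ne4f2";
  "Ng8f6 Nf6e4 Ne4d2";
  "Pd7d5 Bc8g4 Bg4e2";
  "Qd8b6 Qb6f2 Qf2g1";
  "Nf6d5 Nd5f4 Nf4g2";
  "Qd8d2 Qd2e1";
  "Qd8h4 Qh4f2 Qf2f1";
  "Qd8c7 Qc7h2 Qh2g1";
  "Na6b4 Nb4c2";
  "Nc6b4 Nb4c2";
  "Bf8c5 Bc5f2 Bf2g1";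
  "Ng4f2";
  "Nc6a5 Na5c4 Nc4d2";
  "Pd7d5 Bc8g4 Bg4d1";
  "Nf6e4 Ne4d2 Nd2f3";
  "Nd5c3 Nc3e2 Ne2g1";
  "Qd8f6 Qf6f3";
  "Bf8c5 Bc5f2 Bf2e1";
  "Qd8h4 Qh4a4 Qa4d1";
  "Qd8g5 Qg5d2";
  "Ne4f2";
  "Nd5b4 Nb4c2";
  "Qd8d7 Qd7d2 Qd2e1"].

Definition black23_replies : seq (seq step) :=
  Eval vm_compute in map read_plan [::
  "Ng8f6 Rh8g8 Nb8c6";
  "Ng8f6 Nb8a6 Pc7c6";
  "Ng8f6 Pe7e5 Nf6d5";
  "Nb8a6 Pe7e5 Ke8e7";
  "Ng8f6 Nb8c6 Pg7g6";
  "Ng8f6 Nb8c6 Nf6g4";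
  "Ng8f6 Rh8g8 Nf6e4";
  "Ng8f6 Nb8a6 Pe7e6"].

Close Scope string_scope.

(** * The cases of the theorem *)

Lemma white_wins_4 i j : 4 <= i -> 0 < j -> has_winning_strategy i j White.
Proof.
move=> le_i j_gt0; have i_gt0 : 0 < i by apply: leq_trans le_i.
(* At depth 0 no black turn is searched, so [spare] and [replies] can be empty; [grace] is
   admissible because [4 <= i]. *)
apply: (white_wins (grace := 8) (n := 0) (spare := [::]) (mates := white4_mates)
          (replies := [::]) i_gt0 j_gt0) => //.
  by rewrite (leq_trans (_ : 8 <= 2 * 4)) // leq_mul2l (leq_trans le_i) ?leq_addr.
have: all (fun plan => all (well_formed White) plan && (size plan <= 4)) white4_mates.
  by vm_compute.
by apply: sub_all => plan /andP[-> /leq_trans->].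
Qed.

(** Here and for the other fixed pairs [grace] is the largest admissible value [2 * (i + j)]; depth
    1 means one preparing turn before the capture. *)
Lemma white_wins_2_1 : has_winning_strategy 2 1 White.
Proof.
by apply: (white_wins (grace := 6) (n := 1) (spare := black_spare)
  (mates := white21_mates) (replies := white21_replies)); vm_compute.
Qed.

Lemma white_wins_3_1 : has_winning_strategy 3 1 White.
Proof.
by apply: (white_wins (grace := 8) (n := 1) (spare := black_spare)
  (mates := white3_mates) (replies := white3_replies)); vm_compute.
Qed.

Lemma white_wins_3_2 : has_winning_strategy 3 2 White.
Proof.
by apply: (white_wins (grace := 10) (n := 1) (spare := black_spare)
  (mates := white3_mates) (replies := white3_replies)); vm_compute.
Qed.

Lemma white_wins_3_3 : has_winning_strategy 3 3 White.
Proof.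
by apply: (white_wins (grace := 12) (n := 1) (spare := black_spare)
  (mates := white3_mates) (replies := white3_replies)); vm_compute.
Qed.

Lemma black_wins_4 i j : 0 < i < 4 -> 4 <= j -> has_winning_strategy i j Black.
Proof.
move=> /andP[i_gt0 lt_i] le_j.
have j_gt0 : 0 < j by apply: leq_trans le_j.
apply: (black_wins (grace := 10) (n := 0) (spare := white_spare)
          (mates := black4_mates) (replies := [::]) i_gt0 j_gt0) => //.
(* 10 is the least value of [2 * (i + j)] in this case. *)
- by rewrite (leq_trans (_ : 10 <= 2 * (1 + 4))) // leq_mul2l leq_add.
- have: all (fun plan => all (well_formed Black) plan && (size plan <= 4)) black4_mates.
    by vm_compute.
  by apply: sub_all => plan /andP[-> /leq_trans->].
(* The search depends on [i] alone, so three computations settle all [j]. *)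
- by case: i i_gt0 lt_i => [|[|[|[|i]]]] // _ _; vm_compute.
Qed.

Lemma black_wins_1_3 : has_winning_strategy 1 3 Black.
Proof.
by apply: (black_wins (grace := 8) (n := 1) (spare := white_spare)
  (mates := black13_mates) (replies := black13_replies)); vm_compute.
Qed.

(** Two preparing turns may outlast the two rounds covered by [grace]; from then on [safe] compares
    grids. *)
Lemma black_wins_1_2 : has_winning_strategy 1 2 Black.
Proof.
by apply: (black_wins (grace := 6) (n := 2) (spare := white_spare)
  (mates := black12_mates) (replies := black12_replies)); vm_compute.
Qed.

Lemma black_wins_2_3 : has_winning_strategy 2 3 Black.
Proof.
by apply: (black_wins (grace := 10) (n := 1) (spare := white_spare)
  (mates := black23_mates) (replies := black23_replies)); vm_compute.
Qed.

Theorem theorem1 (i j : nat) (hi : 0 < i) (hj : 0 < j)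
    (h11 : (i, j) <> (1, 1)) (h22 : (i, j) <> (2, 2)) :
  (minn j 4 <= i -> has_winning_strategy i j White) /\
  (i < minn j 4 -> has_winning_strategy i j Black).
Proof.
have [le_i | lt_i] := leqP 4 i.
  split=> [_ | ]; first exact: white_wins_4.
  by rewrite leq_min => /andP[_]; rewrite ltnNge le_i.
have [le_j | lt_j] := leqP 4 j.
  split; first by rewrite leqNgt lt_i.
  by move=> _; apply: black_wins_4; rewrite ?hi.
(* Seven pairs with both entries below 4 remain, and for each of them computation discards one of
   the two claims. *)
case: i hi lt_i h11 h22 => [|[|[|[|i]]]] // _ _;
  case: j hj lt_j => [|[|[|[|j]]]] // _ _ h11 h22; split=> // _.
- exact: black_wins_1_2.
- exact: black_wins_1_3.
- exact: white_wins_2_1.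
- exact: black_wins_2_3.
- exact: white_wins_3_1.
- exact: white_wins_3_2.
- exact: white_wins_3_3.
Qed.
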